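(* Let $n\geq 3$ and consider the set of weights $\mathcal{W}_n=\{|D(X)|:X\in(\mathbb{Z}/2\mathbb{Z})^n\}$. The smallest nonzero element of $\mathcal{W}_n$ is $w_1=n$, the second-smallest nonzero element of $\mathcal{W}_n$ is $w_2=2(n-1)$, and \[ \max_{X\in(\mathbb{Z}/2\mathbb{Z})^n}|D(X)|=\left\lfloor\frac{(n+1)^2}{4}\right\rfloor. \]
   Context: For $X=(a_0,\ldots,a_{n-1})\in(\mathbb{Z}/2\mathbb{Z})^n$, the (binary) Delannoy--Steinhaus triangle $D(X)=(a_{i,j})$ is defined for $0\leq i\leq n-1$ and $0\leq j\leq n-i-1$ by $a_{0,j}=a_j$ and, in $\mathbb{Z}/2\mathbb{Z}$, \[ a_{1,j}=a_{0,j}+a_{0,j+1}\quad(0\leq j\leq n-2), \] \[ a_{i+1,j}=a_{i,j}+a_{i,j+1}+a_{i-1,j+1}\quad(1\leq i\leq n-2,\ 0\leq j\leq n-i-2). \] The weight $|D(X)|$ is the number of entries $a_{i,j}$ of the triangle (all rows, including row $0$) equal to $1$. ''Second-smallest nonzero element'' refers to distinct values: it is the smallest element of $\mathcal{W}_n$ strictly greater than $w_1$. *)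

(* Defs.v *)
From mathcomp Require Import all_boot all_algebra.

Set Implicit Arguments.
Unset Strict Implicit.
Unset Printing Implicit Defensive.

Import GRing.Theory.
Local Open Scope ring_scope.

(* [DS_entry x i j] is total in [i] and [j]; it is the entry a_(i,j) of the
   Delannoy--Steinhaus triangle D(x) when [i < size x] and [j < size x - i]. In
   that range the recursion never reaches the default value 0 of [x`_j]. *)
Fixpoint DS_entry (x : seq 'Z_2) (i j : nat) {struct i} : 'Z_2 :=
  match i with
  | 0 => x`_j
  | 1 => x`_j + x`_j.+1
  | (i''.+1 as i').+1 =>
      DS_entry x i' j + DS_entry x i' j.+1 + DS_entry x i'' j.+1
  end.

Definition DS_weight (n : nat) (X : n.-tuple 'Z_2) : nat :=
  #|[set p : 'I_n * 'I_n | (p.2 < n - p.1)%N && (DS_entry X p.1 p.2 == 1)]|.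

Definition DS_weights (n : nat) : pred nat :=
  [pred w | [exists X : n.-tuple 'Z_2, DS_weight X == w]].

Definition is_least (P : pred nat) (w : nat) : Prop :=
  w \in P /\ forall v : nat, v \in P -> (w <= v)%N.

(* Main.v *)
Require Import Defs.
From mathcomp Require Import all_boot all_algebra.
From mathcomp Require Import zify.

Import GRing.Theory.

(** The recursion is a discrete wave equation: rewriting it in the coordinates
    [i + j] and [j], its solutions are the sums [f (i + j) + g j], and the two
    initial rows force [f] and [g] to be shifts of one sequence, the partial sums
    [s 0, ..., s n] of the first row.  Concretely
    [a_(i, j) = s j + s (i + j + 1)] (lemma [DS_entryE]), so the entries of the
    triangle are the sums [s j + s k] over all pairs [j < k <= n].  Such an entry
    is 1 exactly when one of [s j], [s k] is 1 and the other is 0.  If [m] of the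
    [n + 1] partial sums are 1, the weight is therefore [m * (n + 1 - m)]
    (lemma [DS_weightE]).

    A first row with a single 1 has partial sums 0, ..., 0, 1, ..., 1, and the
    place of the 1 is that of the step, so every product [p * q] with
    [p + q = n + 1] and [p, q > 0] is a weight (lemma [DS_weight_unit_row]).  What
    is left is arithmetic about such products: the inequalities
    [(p - 1) * (q - 1) >= 0], [(p - 2) * (q - 2) >= 0] and [(p - q) ^ 2 >= 0]
    give the two smallest nonzero values and the largest one. *)

Definition psum (x : seq 'Z_2) (k : nat) : 'Z_2 := (\sum_(l < k) x`_l)%R.

Lemma psumS x k : psum x k.+1 = (psum x k + x`_k)%R.
Proof. by rewrite /psum big_ord_recr. Qed.

Lemma addZ2_self (a : 'Z_2) : (a + a = 0)%R.
Proof. by case: a => [[|[|]]] // ?; apply: val_inj. Qed.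

Lemma addZ2_eq1 (a b : 'Z_2) : (a + b == 1)%R = (a == 1%R) (+) (b == 1%R).
Proof. by case: a => [[|[|]]] // ?; case: b => [[|[|]]]. Qed.

(** In the sum of three entries that defines row [i + 2], the terms
    [psum x j.+1] and [psum x (i + j).+2] each occur twice and cancel. *)
Lemma DS_entryE x i j : DS_entry x i j = (psum x j + psum x (i + j).+1)%R.
Proof.
(* The recursion has depth two, so two consecutive rows are carried along. *)
suff: DS_entry x i j = (psum x j + psum x (i + j).+1)%R /\
      DS_entry x i.+1 j = (psum x j + psum x (i.+1 + j).+1)%R by case.
elim: i j => [|i IHi] j.
  by rewrite /= !psumS !addrA addZ2_self !add0r.
have [IH0 IH1] := IHi j; split=> //.
have [IH0' IH1'] := IHi j.+1.
have -> : DS_entry x i.+2 j =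
  (DS_entry x i.+1 j + DS_entry x i.+1 j.+1 + DS_entry x i j.+1)%R by [].
rewrite IH1 IH1' IH0' !addnS !addSn.
set a := psum x j; set b := psum x j.+1; set c := psum x (i + j).+2.
set d := psum x (i + j).+3.
by rewrite [(b + d)%R]addrC -addrA [(d + b + _)%R]addrA -[(d + b + b)%R]addrA
           addZ2_self addr0 [(d + c)%R]addrC addrA -[(a + c + c)%R]addrA
           addZ2_self addr0.
Qed.

Definition psum_ones {n} (X : n.-tuple 'Z_2) : {set 'I_n.+1} :=
  [set k : 'I_n.+1 | psum X k == 1%R].

(** The entries equal to 1 correspond to the pairs [(u, v)] with [u] in
    [psum_ones X] and [v] outside: the entry [(i, j)] comes from the pair whose
    smaller and larger members are [j] and [i + j + 1]. *)
Lemma DS_weightE n (X : n.-tuple 'Z_2) :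
  DS_weight X = #|psum_ones X| * (n.+1 - #|psum_ones X|).
Proof.
(* For [n = 0] both sides vanish; for [n > 0] the type ['I_n] of the entry
   indices is inhabited, as [inord] requires below. *)
case: n X => [|n] X.
  have -> : DS_weight X = 0.
    by apply/eqP; rewrite cards_eq0; apply/eqP/setP => [[[]]].
  have : #|psum_ones X| <= 1 by rewrite -[leqRHS](card_ord 1) max_card.
  by case: #|_| => [|[]].
pose S := psum_ones X; rewrite -/S.
have -> : (n.+2 - #|S|) = #|~: S| by rewrite [in RHS]cardsCs setCK card_ord.
rewrite -cardsX.
pose f (q : 'I_n.+2 * 'I_n.+2) : 'I_n.+1 * 'I_n.+1 :=
  (inord ((maxn q.1 q.2) - (minn q.1 q.2)).-1, inord (minn q.1 q.2)).
have inS (k : 'I_n.+2) : (k \in S) = (psum X k == 1%R) by rewrite inE.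
have Sneq q : q \in setX S (~: S) -> q.1 <> q.2 :> nat.
  by case: q => u v; rewrite !in_setX in_setC => /andP[/= uS vS] /val_inj uv;
     rewrite -uv uS in vS.
have fE q : q \in setX S (~: S) ->
    (f q).1 = ((maxn q.1 q.2) - (minn q.1 q.2)).-1 :> nat /\
    (f q).2 = minn q.1 q.2 :> nat.
  move=> /Sneq; case: q => u v /= uv.
  by have := ltn_ord u; have := ltn_ord v => ? ?; rewrite !inordK; lia.
rewrite -(@card_in_imset _ _ f).
  rewrite /DS_weight; apply: eq_card => -[i j]; rewrite inE /= DS_entryE addZ2_eq1.
  apply/andP/imsetP => [[lt_j ji1]|[q qS fq]].
    have ltij : (i + j).+1 < n.+2 by have := ltn_ord i; lia.
    have ltj : j < n.+2 by lia.
    pose k := Ordinal ltij; pose l := Ordinal ltj.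
    have: (l \in S) (+) (k \in S) by rewrite !inS.
    have [lS /= kS|lS /= kS] := boolP (l \in S).
      exists (l, k); first by rewrite in_setX in_setC lS kS.
      by congr pair; apply: val_inj; rewrite /= inordK; lia.
    exists (k, l); first by rewrite in_setX in_setC lS kS.
    by congr pair; apply: val_inj; rewrite /= inordK; lia.
  have [] := fE q qS; rewrite -fq /= => iE jE.
  have := Sneq q qS; case: q {fq} qS iE jE => u v.
  rewrite in_setX in_setC !inS => /= /andP[uS vS] iE jE uv.
  have := ltn_ord u; have := ltn_ord v => ? ?.
  split; first by lia.
  have [lt_uv|] := ltnP u v.
    have -> : (i + j).+1 = v by lia.
    have -> : j = u :> nat by lia.
    by rewrite uS (negbTE vS).
  move=> le_vu.
  have -> : (i + j).+1 = u by lia.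
  have -> : j = v :> nat by lia.
  by rewrite uS (negbTE vS).
(* Injectivity: [f q] determines the minimum and the maximum of [q], and only
   one of the two ways to order them has its first member in [S]. *)
move=> q q' qS q'S fqq'.
have [e1 e2] := fE q qS; have [e1' e2'] := fE q' q'S.
rewrite fqq' in e1 e2; have := Sneq q qS; have := Sneq q' q'S.
case: q q' qS q'S e1 e2 e1' e2' {fqq'} => u v [u' v'].
rewrite !in_setX !in_setC => /= /andP[uS vS] /andP[u'S v'S] e1 e2 e1' e2' n' n0.
have [[/val_inj -> /val_inj -> //]|uv'] :
  (u = u' :> nat /\ v = v' :> nat) \/ u = v' :> nat by lia.
by move/val_inj: uv' v'S => <-; rewrite uS.
Qed.

(** For [m = n] the 1 falls outside the row, which is then zero; its partial
    sums still follow the pattern of [psum_unit_row]. *)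
Definition unit_row (n m : nat) : n.-tuple 'Z_2 :=
  [tuple of mkseq (fun l => ((l == m)%:R)%R) n].

Lemma psum_unit_row n m k : k <= n -> psum (unit_row n m) k = ((m < k)%:R)%R.
Proof.
elim: k => [|k IHk] lt_kn; first by rewrite /psum big_ord0 ltn0.
rewrite psumS IHk ?(ltnW lt_kn) // nth_mkseq // ltnS.
by case: (ltngtP m k) => // _; rewrite ?addr0 ?add0r.
Qed.

Lemma DS_weight_unit_row n m : m <= n -> DS_weight (unit_row n m) = m.+1 * (n - m).
Proof.
move=> le_mn; rewrite DS_weightE.
have -> : #|psum_ones (unit_row n m)| = n - m.
  (* The zeros, that is the indices at most m, are easier to count. *)
  rewrite cardsCs card_ord.
  have -> : #|~: psum_ones (unit_row n m)| = m.+1; last by rewrite subSS.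
  rewrite -sum1_card.
  rewrite (eq_bigl (fun k : 'I_n.+1 => k < m.+1)).
    by rewrite (big_ord_narrow (le_mn : m.+1 <= n.+1)) sum1_card card_ord.
  move=> k; rewrite !inE psum_unit_row; last by rewrite -ltnS.
  by rewrite ltnS; case: leqP.
by rewrite mulnC; congr muln; lia.
Qed.

Lemma DS_weightsP n w : w \in DS_weights n ->
  exists p q, p + q = n.+1 /\ w = p * q.
Proof.
case/existsP => X /eqP <-; exists #|psum_ones X|, (n.+1 - #|psum_ones X|).
by split; [rewrite subnKC // -[leqRHS]card_ord max_card | exact: DS_weightE].
Qed.

Lemma mem_DS_weights n m : m <= n -> m.+1 * (n - m) \in DS_weights n.
Proof.
by move=> le_mn; apply/existsP; exists (unit_row n m); rewrite DS_weight_unit_row.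
Qed.

Lemma leq_mul_sqr_div4 p q : p * q <= (p + q) ^ 2 %/ 4.
Proof. by rewrite leq_divRL // mulnC nat_AGM2. Qed.

Lemma half_mul_half k : k./2 * (k - k./2) = k ^ 2 %/ 4.
Proof.
rewrite -{2 4}(odd_double_half k); set h := k./2.
have -> : odd k + h.*2 - h = h + odd k by lia.
by case: (odd k) => /=; lia.
Qed.

Theorem theorem4p4 (n : nat) (hn : 3 <= n) :
  [/\ is_least [pred w in DS_weights n | w != 0] n,
      is_least [pred w in DS_weights n | n < w] (2 * (n - 1))
    & \max_(X : n.-tuple 'Z_2) DS_weight X = (n + 1) ^ 2 %/ 4].
Proof.
split.
- split.
    rewrite inE; apply/andP; split; last by lia.
    by have := @mem_DS_weights n 0 isT; rewrite mul1n subn0.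
  move=> v /andP[/DS_weightsP[p [q [pq ->]]]].
  case: p q pq => [|p] [|q] pq //; rewrite ?muln0 // => _.
  by nia.
- split.
    rewrite inE; apply/andP; split; last by lia.
    by apply: mem_DS_weights; lia.
  move=> v /andP[/DS_weightsP[p [q [pq ->]]]].
  (* A factor 0 or 1 gives the weight 0 or [n], so both factors are at least 2
     and [(p - 2) * (q - 2) >= 0] is the claim. *)
  case: p q pq => [|[|p]] [|[|q]] pq lt_n; simpl in lt_n; nia.
(* Two factors with sum [n + 1] have the largest product when they differ by at
   most 1, hence the step at the middle of the row. *)
- apply/eqP; rewrite eqn_leq; apply/andP; split.
    apply/bigmax_leqP => X _.
    have /DS_weightsP[p [q [pq ->]]] : DS_weight X \in DS_weights n.
      by apply/existsP; exists X.
    by rewrite addn1 -pq leq_mul_sqr_div4.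
  have le_hn : (n.+1)./2.-1 <= n by lia.
  have <- : DS_weight (unit_row n (n.+1)./2.-1) = (n + 1) ^ 2 %/ 4.
    rewrite DS_weight_unit_row // addn1 -half_mul_half; congr muln; lia.
  exact: (leq_bigmax (unit_row n (n.+1)./2.-1)).
Qed.
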